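(* Let $d\ge 2$ and let $\rho$ be a diagonal symmetric state on $\mathbb{C}^d\otimes\mathbb{C}^d$ that is PPT (i.e. $\rho^{T_B}\succeq 0$), and suppose its associated matrix $M(\rho)$ has rank at most $2$. Then $\rho$ is separable.
   Context: Let $\{\ket{0},\dots,\ket{d-1}\}$ be the computational basis of $\mathbb{C}^d$. Define $\ket{D_{ii}}=\ket{ii}$ and, for $i<j$, $\ket{D_{ij}}=(\ket{ij}+\ket{ji})/\sqrt{2}$. A state $\rho$ on $\mathbb{C}^d\otimes\mathbb{C}^d$ is diagonal symmetric (DS) if $\rho=\sum_{0\le i\le j<d}p_{ij}\ket{D_{ij}}\bra{D_{ij}}$ with $p_{ij}\ge 0$ and $\sum_{i\le j}p_{ij}=1$; set $p_{ji}=p_{ij}$. Its associated matrix $M(\rho)$ is the real symmetric $d\times d$ matrix with $M(\rho)_{ii}=p_{ii}$ and $M(\rho)_{ij}=p_{ij}/2$ for $i\ne j$. A state is separable if it is a convex combination of product states $\rho^A\otimes\rho^B$. The partial transpose $\rho^{T_B}$ is taken with respect to the computational basis of the second factor. *)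

(* Defs.v *)
From HB Require Import structures.
From mathcomp Require Import all_boot all_order all_algebra.
From mathcomp Require Import complex.
From mathcomp Require Import reals.
Set Implicit Arguments. Unset Strict Implicit. Unset Printing Implicit Defensive.
Import Order.TTheory GRing.Theory Num.Theory.
Local Open Scope ring_scope.
Local Open Scope complex_scope.

Section QInfo.
Variable R : realType.
Local Notation C := R[i].

Definition adjmx m n (A : 'M[C]_(m, n)) : 'M[C]_(n, m) :=
  \matrix_(i, j) (A j i)^*.

Definition psd n (A : 'M[C]_n) : Prop :=
  adjmx A = A /\ forall v : 'cV[C]_n, 0 <= (adjmx v *m A *m v) 0 0.

Definition is_state n (A : 'M[C]_n) : Prop := psd A /\ \tr A = 1.

(* Kronecker product on C^d (x) C^d, basis |i j> indexed by mxvec_index i j *)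
Definition kron d (A B : 'M[C]_d) : 'M[C]_(d * d) :=
  \matrix_(a, b) (let: (i, k) := enum_val (cast_ord (esym (mxvec_cast d d)) a) in
                  let: (j, l) := enum_val (cast_ord (esym (mxvec_cast d d)) b) in
                  A i j * B k l).

Definition ptB d (rho : 'M[C]_(d * d)) : 'M[C]_(d * d) :=
  \matrix_(a, b) (let: (i, k) := enum_val (cast_ord (esym (mxvec_cast d d)) a) in
                  let: (j, l) := enum_val (cast_ord (esym (mxvec_cast d d)) b) in
                  rho (mxvec_index i l) (mxvec_index j k)).

Definition PPT d (rho : 'M[C]_(d * d)) : Prop := psd (ptB rho).

Definition separable d (rho : 'M[C]_(d * d)) : Prop :=
  exists (n : nat) (w : 'I_n -> R) (A B : 'I_n -> 'M[C]_d),
    (forall k, 0 <= w k) /\ \sum_(k < n) w k = 1 /\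
    (forall k, is_state (A k)) /\ (forall k, is_state (B k)) /\
    rho = \sum_(k < n) (w k)%:C *: kron (A k) (B k).

Definition ket d (i j : 'I_d) : 'cV[C]_(d * d) := delta_mx (mxvec_index i j) 0.

Definition Dket d (i j : 'I_d) : 'cV[C]_(d * d) :=
  if i == j then ket i i
  else ((Num.sqrt (2 : R))^-1)%:C *: (ket i j + ket j i).

Definition DS_coeffs d (p : 'M[R]_d) : Prop :=
  p^T = p /\ (forall i j, 0 <= p i j) /\
  \sum_(i < d) \sum_(j < d | (i <= j)%N) p i j = 1.

Definition DS_state d (p : 'M[R]_d) : 'M[C]_(d * d) :=
  \sum_(i < d) \sum_(j < d | (i <= j)%N) (p i j)%:C *: (Dket i j *m adjmx (Dket i j)).

Definition Mmat d (p : 'M[R]_d) : 'M[R]_d :=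
  \matrix_(i, j) (if i == j then p i j else p i j / 2).

End QInfo.

(* Main.v *)
(* Testing the partial transpose on vectors [sum_i x_i |ii>] shows that [M] is
   positive semidefinite, so rank at most 2 makes it the Gram matrix of planar
   vectors [(u_i, v_i)]. Since [M] has nonnegative entries, these vectors are
   pairwise at acute angles and can be rotated into the positive quadrant, which
   writes [M = u u^T + v v^T] with [u, v >= 0]. Finally a term [u u^T] of [M]
   contributes to the state the average of [psi psi^* (x) psi psi^*] over the
   vectors [psi = sum_i sqrt(u_i) z_i |i>] with independent fourth roots of unity
   [z_i]: the average kills every entry [|ik><jl|] unless [{i,k} = {j,l}]. *)
Require Import Defs.
From HB Require Import structures.
From mathcomp Require Import all_boot all_order all_algebra.
From mathcomp Require Import complex reals ring lra.
Import Order.TTheory GRing.Theory Num.Theory.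
Local Open Scope ring_scope.

(** * Positive semidefinite matrices of low rank as Gram matrices *)

Lemma psd_diag0_eq0 (R : realFieldType) (d : nat) (M : 'M[R]_d) :
    M^T = M -> (forall x : 'cV_d, 0 <= (x^T *m M *m x) 0 0) ->
  (forall i, M i i = 0) -> M = 0.
Proof.
move=> symM psdM diag0; apply/matrixP => i j; rewrite mxE.
have entry k l : (delta_mx k 0 : 'cV_d)^T *m M *m (delta_mx l 0 : 'cV_d) = (M k l)%:M.
  by rewrite [LHS]mx11_scalar trmx_delta -rowE -colE !mxE.
have Mji : M j i = M i j by rewrite -{1}symM mxE.
(* With zero diagonal the form at [e_i + c e_j] is [2 c M_ij]; both signs of [c] then force
   [M_ij = 0]. *)
have ge0 c : 0 <= c * M i j *+ 2.
  have := psdM (delta_mx i 0 + c *: delta_mx j 0).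
  rewrite [(_ + _)^T]linearD /= [(_ *: _)^T]linearZ /=
    !(mulmxDl, mulmxDr) -!scalemxAl -!scalemxAr !entry.
  by rewrite !mxE !diag0 Mji /= !mulr1n !mulr0 addr0 add0r mulr2n.
by have := ge0 1; have := ge0 (-1); lra.
Qed.

(** One Cholesky step. For a pivot [M a a != 0], subtracting [(M e)(M e)^T / M a a] with [e = e_a]
    puts [e] in the kernel, where it was not before, so the rank drops. Without a pivot, [M = 0] and
    [u = 0] serves. *)
Lemma psd_rank_reduction (R : rcfType) (d : nat) (M : 'M[R]_d) :
    M^T = M -> (forall x : 'cV_d, 0 <= (x^T *m M *m x) 0 0) ->
  exists u : 'cV_d, let N := M - u *m u^T in
    [/\ N^T = N, forall x : 'cV_d, 0 <= (x^T *m N *m x) 0 0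
      & (\rank N <= (\rank M).-1)%N].
Proof.
move=> symM psdM.
case: (pickP (fun a => M a a != 0)) => [a nz|diag0]; last first.
  have M0 : M = 0.
    by apply: psd_diag0_eq0 => // i; apply/eqP; have := diag0 i; case: eqP.
  exists 0; rewrite mul0mx subr0; split=> //.
  by rewrite M0 mxrank0.
set e : 'cV[R]_d := delta_mx a 0; set al := M a a in nz *.
have eMe : e^T *m M *m e = al%:M.
  by rewrite [LHS]mx11_scalar trmx_delta -rowE -colE !mxE.
have al_ge0 : 0 <= al by have := psdM e; rewrite eMe mxE eqxx.
exists ((Num.sqrt al)^-1 *: (M *m e)); set N := M - _.
have NE : N = M - al^-1 *: (M *m e *m e^T *m M).
  rewrite /N [(_ *: _)^T]linearZ /= -scalemxAl -scalemxAr scalerA -invfM -expr2 sqr_sqrtr //.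
  by rewrite trmx_mul symM !mulmxA.
(* [P] is the projection along [e] onto its [M]-orthogonal complement; [N = P^T M P] is then visibly
   semidefinite. *)
pose P := 1%:M - al^-1 *: (e *m e^T *m M).
have NMP : N = M *m P by rewrite NE mulmxBr mulmx1 -scalemxAr !mulmxA.
have Ne : N *m e = 0.
  rewrite NE mulmxBl -scalemxAl -!mulmxA (mulmxA _ M e) eMe mulmxA mul_mx_scalar.
  by rewrite scalerA mulVf // scale1r subrr.
have symN : N^T = N by rewrite /N [(_ - _)^T]linearB /= trmx_mul trmxK symM.
have NPMP : N = P^T *m M *m P.
  have eN : e^T *m N = 0 by rewrite -symN -trmx_mul Ne trmx0.
  rewrite -mulmxA -NMP /P [(_ - _)^T]linearB /= [(_ *: _)^T]linearZ /=
    !trmx_mul trmxK symM trmx1.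
  by rewrite mulmxBl mul1mx -scalemxAl -!mulmxA eN !mulmx0 scaler0 subr0.
split=> //.
- move=> x; have := psdM (P *m x).
  by rewrite NPMP trmx_mul !mulmxA.
- have NM : (N <= M)%MS by rewrite -symN NMP trmx_mul symM submxMl.
  have : (N < M)%MS.
    (* Equal row spaces would give [M = D N], hence [e^T M e = 0], against the choice of the
       pivot. *)
    rewrite ltmxE NM; apply/negP => /submxP [D MD].
    by move: nz; have := eMe; rewrite MD -!mulmxA Ne !mulmx0 => /matrixP/(_ 0 0);
       rewrite !mxE eqxx mulr1n => al0; rewrite -al0 eqxx.
  by move/rank_ltmx; case: (\rank M).
Qed.

Lemma psd_rank2 (R : rcfType) (d : nat) (M : 'M[R]_d) :
    M^T = M -> (forall x : 'cV_d, 0 <= (x^T *m M *m x) 0 0) ->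
    (\rank M <= 2)%N ->
  exists u v : 'I_d -> R, forall i j, M i j = u i * u j + v i * v j.
Proof.
move=> symM psdM rkM.
have [u [symN psdN rkN]] := psd_rank_reduction _ _ _ symM psdM.
have [v [_ _ rkN']] := psd_rank_reduction _ _ _ symN psdN.
have /eqP : \rank (M - u *m u^T - v *m v^T) = 0%N.
  apply/eqP; rewrite -leqn0 (leq_trans rkN') // -!subn1 leq_subLR (leq_trans rkN) //.
  by rewrite -subn1 leq_subLR.
rewrite mxrank_eq0 -addrA -opprD subr_eq0 => /eqP ->.
exists (fun i => u i 0), (fun i => v i 0) => i j.
by rewrite !mxE !big_ord1 !mxE.
Qed.

(** * Planar vectors at pairwise acute angles *)

(** The quantity [u a * v j - v a * u j] is the cross product of the vectors [a] and [j], so [a] is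
    a clockwise-most nonzero vector. Induction on the list keeps the current extreme one unless the
    new vector lies clockwise of it. *)
Lemma extreme_planar_vector (R : realFieldType) (T : eqType) (u v : T -> R) (s : seq T) :
    (forall i j, 0 <= u i * u j + v i * v j) ->
  (forall i, i \in s -> u i = 0 /\ v i = 0) \/
  exists2 a, 0 < u a ^+ 2 + v a ^+ 2 & forall j, j \in s -> 0 <= u a * v j - v a * u j.
Proof.
move=> acute; elim: s => [|b s IHs]; first by left.
have sq_gt0 i : ~~ ((u i == 0) && (v i == 0)) -> 0 < u i ^+ 2 + v i ^+ 2.
  move=> nz; rewrite lt_def addr_ge0 ?sqr_ge0 // andbT.
  by rewrite paddr_eq0 ?sqr_ge0 // !sqrf_eq0.
case: (boolP ((u b == 0) && (v b == 0))) => [/andP[/eqP ub /eqP vb]|/sq_gt0 b_gt0].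
  case: IHs => [z|[a a_gt0 ext_a]]; [left|right].
    by move=> i; rewrite inE => /predU1P[->//|/z].
  exists a => // j; rewrite inE => /predU1P[->|/ext_a//].
  by rewrite ub vb !mulr0 subr0.
right; case: IHs => [z|[a a_gt0 ext_a]].
  exists b => // j; rewrite inE => /predU1P[->|/z[-> ->]].
    by rewrite mulrC subrr.
  by rewrite !mulr0 subr0.
case: (lerP 0 (u a * v b - v a * u b)) => [ab|/ltW ba].
  by exists a => // j; rewrite inE => /predU1P[->|/ext_a].
exists b => // j; rewrite inE => /predU1P[->|/ext_a aj].
  by rewrite mulrC subrr.
rewrite -(pmulr_rge0 _ a_gt0).
(* Transitivity of the angular order: [|a|^2 (b x j) = -(a x b)(a.j) + (a.b)(a x j)], where each
   factor on the right has a known sign. *)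
have -> : (u a ^+ 2 + v a ^+ 2) * (u b * v j - v b * u j) =
   (- (u a * v b - v a * u b)) * (u a * u j + v a * v j) +
   (u a * u b + v a * v b) * (u a * v j - v a * u j) by ring.
by rewrite addr_ge0 // mulr_ge0 // ?oppr_ge0.
Qed.

(* Rotating an extreme vector of the family onto the first axis moves the whole
   family into the positive quadrant. *)
Lemma acute_planar_family_nonneg (R : rcfType) (T : finType) (u v : T -> R) :
    (forall i j, 0 <= u i * u j + v i * v j) ->
  exists u' v' : T -> R, [/\ forall i, 0 <= u' i, forall i, 0 <= v' i
    & forall i j, u i * u j + v i * v j = u' i * u' j + v' i * v' j].
Proof.
move=> acute.
case: (extreme_planar_vector _ _ _ _ (enum T) acute) => [z|[a a_gt0 ext_a]].
  exists u, v; split=> // i; have [] := z i; rewrite ?mem_enum // => ui vi.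
    by rewrite ui.
  by rewrite vi.
set n := _ + _ in a_gt0; set r := Num.sqrt n.
have r2 : r ^+ 2 = n by rewrite sqr_sqrtr // ltW.
have r_gt0 : 0 < r by rewrite sqrtr_gt0.
(* Coordinates in the orthonormal frame whose first axis points along [a]: dot and cross product
   with [a], divided by its length [r]. *)
exists (fun i => (u a * u i + v a * v i) / r), (fun i => (u a * v i - v a * u i) / r).
split=> [i|i|i j].
- by rewrite divr_ge0 // ltW.
- by rewrite divr_ge0 ?(ltW r_gt0) // ext_a // mem_enum.
- apply: (mulfI (lt0r_neq0 a_gt0)).
  (* Lagrange's identity [|a|^2 (i.j) = (a.i)(a.j) + (a x i)(a x j)]. *)
  transitivity ((u a * u i + v a * v i) * (u a * u j + v a * v j) +
     (u a * v i - v a * u i) * (u a * v j - v a * u j)); first by rewrite /n; ring.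
  by rewrite -r2; field; rewrite lt0r_neq0.
Qed.

(** * Entries of diagonal symmetric states in the product basis *)

Lemma mxvec_indexK (d : nat) (i k : 'I_d) :
  enum_val (cast_ord (esym (mxvec_cast d d)) (mxvec_index i k)) = (i, k).
Proof. by rewrite /mxvec_index cast_ordK enum_rankK. Qed.

Lemma mxvec_index_eq (d : nat) (i k j l : 'I_d) :
  (mxvec_index i k == mxvec_index j l) = (i == j) && (k == l).
Proof.
apply/eqP/andP => [E|[/eqP-> /eqP->] //].
have := mxvec_indexK d i k; rewrite E mxvec_indexK.
by move=> [<- <-]; rewrite !eqxx.
Qed.

Lemma sum_mxvec_index (V : nmodType) (d : nat) (F : 'I_(d * d) -> V) :
  \sum_a F a = \sum_i \sum_k F (mxvec_index i k).
Proof.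
rewrite (reindex _ (curry_mxvec_bij d d)) /= pair_bigA /=.
by apply: eq_bigr => -[i k].
Qed.

Section Entries.
Local Open Scope complex_scope.
Variable R : realType.
Local Notation C := R[i].

Lemma kronE (d : nat) (A B : 'M[C]_d) (i k j l : 'I_d) :
  kron A B (mxvec_index i k) (mxvec_index j l) = A i j * B k l.
Proof. by rewrite mxE !mxvec_indexK. Qed.

Lemma ptBE (d : nat) (rho : 'M[C]_(d * d)) (i k j l : 'I_d) :
  ptB rho (mxvec_index i k) (mxvec_index j l) =
  rho (mxvec_index i l) (mxvec_index j k).
Proof. by rewrite mxE !mxvec_indexK. Qed.

Lemma ketE (d : nat) (i j k l : 'I_d) :
  ket R i j (mxvec_index k l) 0 = ((i == k) && (j == l))%:R.
Proof. by rewrite mxE eqxx andbT mxvec_index_eq eq_sym [l == j]eq_sym. Qed.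

Lemma Dket_swap (d : nat) (i j k l : 'I_d) :
  Dket R i j (mxvec_index k l) 0 = Dket R i j (mxvec_index l k) 0.
Proof.
rewrite /Dket; case: eqP => [_|_]; first by rewrite !ketE andbC.
by rewrite !mxE !mxvec_index_eq !andbT addrC [(l == i) && _]andbC [(l == j) && _]andbC.
Qed.

Lemma Dket_sorted (d : nat) (i j k l : 'I_d) : (i <= j)%N -> (k <= l)%N ->
  Dket R i j (mxvec_index k l) 0 =
  ((i == k) && (j == l))%:R * (if k == l then 1 else (Num.sqrt 2)^-1%:C).
Proof.
move=> ij kl; rewrite /Dket; case: (eqVneq i j) => [<-|nij].
  rewrite ketE; case: eqP => [<-|_]; rewrite ?mul0r //=.
  by case: eqP => _; rewrite ?mul0r ?mul1r.
rewrite mxE [X in _ * X]mxE !ketE.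
have -> : (j == k) && (i == l) = false.
  apply: contraNF nij => /andP[/eqP jk /eqP il].
  by rewrite -val_eqE eqn_leq ij il jk.
rewrite addr0 mulrC; case: andP => [[/eqP<- /eqP<-]|_]; last by rewrite !mul0r.
by rewrite (negPf nij).
Qed.

Lemma DS_state_entry (d : nat) (p : 'M[R]_d) (a b : 'I_(d * d)) :
  DS_state p a b = \sum_(i < d) \sum_(j < d | (i <= j)%N)
    (p i j)%:C * (Dket R i j a 0 * (Dket R i j b 0)^*%C).
Proof.
rewrite /DS_state summxE; apply: eq_bigr => i _; rewrite summxE.
by apply: eq_bigr => j _; rewrite !mxE big_ord1 !mxE.
Qed.

(** On sorted index pairs only the term of [p i k] survives, and the squared normalization
    [1/sqrt 2] is the halving built into [Mmat] off the diagonal. *)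
Lemma DS_state_sorted (d : nat) (p : 'M[R]_d) (i k j l : 'I_d) :
    (i <= k)%N -> (j <= l)%N ->
  DS_state p (mxvec_index i k) (mxvec_index j l) =
  (Mmat p i k)%:C * ((i == j) && (k == l))%:R.
Proof.
move=> ik jl; rewrite DS_state_entry (bigD1 i) //= [X in _ + X]big1 ?addr0; last first.
  move=> i' ne; apply: big1 => j' ij'.
  by rewrite Dket_sorted // (negPf ne) !mul0r mulr0.
rewrite (bigD1 k) //= [X in _ + X]big1 ?addr0; last first.
  move=> k' /andP[ij' ne].
  by rewrite Dket_sorted // (negPf ne) andbF !mul0r mulr0.
rewrite !Dket_sorted // !eqxx mul1r rmorphM /= rmorph_nat.
case: andP => [[/eqP<- /eqP<-]|_]; last by rewrite mul0r !mulr0.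
rewrite mul1r mulr1 mxE; case: eqP => _; first by rewrite rmorph1 !mulr1.
rewrite conjc_real -rmorphM -rmorphM /= -expr2 exprVn sqr_sqrtr //.
Qed.

Lemma Mmat_sym (d : nat) (p : 'M[R]_d) : p^T = p -> (Mmat p)^T = Mmat p.
Proof.
by move=> ps; apply/matrixP => i j; rewrite !mxE eq_sym -{1 2}ps !mxE.
Qed.

(** The vectors [Dket] are invariant under swapping the tensor factors, so each index pair can be
    sorted first. Between sorted pairs, equality as unordered pairs is plain equality. *)
Lemma DS_stateE (d : nat) (p : 'M[R]_d) (i k j l : 'I_d) : p^T = p ->
  DS_state p (mxvec_index i k) (mxvec_index j l) =
  (Mmat p i k)%:C * (((i == j) && (k == l)) || ((i == l) && (k == j)))%:R.
Proof.
move=> /Mmat_sym symM.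
have swapl b : DS_state p (mxvec_index i k) b = DS_state p (mxvec_index k i) b.
  by rewrite !DS_state_entry; apply: eq_bigr => ? _; apply: eq_bigr => ? _; rewrite Dket_swap.
have swapr a : DS_state p a (mxvec_index j l) = DS_state p a (mxvec_index l j).
  by rewrite !DS_state_entry; apply: eq_bigr => ? _; apply: eq_bigr => ? _;
    rewrite [in X in X^*%C]Dket_swap.
have Mki : Mmat p k i = Mmat p i k by rewrite -{1}symM mxE.
have sorted_eq (a b c e : 'I_d) : (a <= b)%N -> (c <= e)%N ->
    ((a == c) && (b == e)) || ((a == e) && (b == c)) = (a == c) && (b == e).
  move=> ab ce; apply: orb_idr => /andP[/eqP ae /eqP bc]; subst e b.
  by suff -> : a = c; [rewrite eqxx | apply: val_inj; apply/eqP; rewrite eqn_leq ab ce].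
case: (leqP i k) => [ik|/ltnW ki]; case: (leqP j l) => [jl|/ltnW lj].
- by rewrite DS_state_sorted // sorted_eq.
- by rewrite swapr DS_state_sorted // orbC sorted_eq.
- rewrite swapl DS_state_sorted // Mki; congr (_ * (nat_of_bool _)%:R).
  by rewrite -[LHS]sorted_eq //; do 4!case: (_ == _).
- rewrite swapl swapr DS_state_sorted // Mki; congr (_ * (nat_of_bool _)%:R).
  by rewrite -[LHS]sorted_eq //; do 4!case: (_ == _).
Qed.

(** The entry of the partial transpose at [|ii><jj|] is that of the state at [|ij><ji|], namely
    [M_ij]; so the form at [sum_i x_i |ii>] is [x^T M x]. *)
Lemma PPT_Mmat_psd (d : nat) (p : 'M[R]_d) : p^T = p -> PPT (DS_state p) ->
  forall x : 'cV_d, 0 <= (x^T *m Mmat p *m x) 0 0.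
Proof.
move=> ps [_ ppt] x.
pose v : 'cV[C]_(d * d) := \col_a (let: (i, k) :=
  enum_val (cast_ord (esym (mxvec_cast d d)) a) in if i == k then (x i 0)%:C else 0).
have vE i k : v (mxvec_index i k) 0 = if i == k then (x i 0)%:C else 0.
  by rewrite mxE mxvec_indexK.
have := ppt v; rewrite -(ler0c (_ 0 0)); congr (0 <= _).
rewrite [LHS]mxE [X in X%:C]mxE rmorph_sum sum_mxvec_index /=.
apply: eq_bigr => j _; rewrite (bigD1 j) //= [X in _ + X]big1 ?addr0; last first.
  by move=> l; rewrite vE eq_sym => /negPf->; rewrite mulr0.
rewrite vE eqxx rmorphM /=; congr (_ * _).
rewrite [LHS]mxE mxE rmorph_sum sum_mxvec_index /=.
apply: eq_bigr => i _; rewrite (bigD1 i) //= [X in _ + X]big1 ?addr0; last first.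
  by move=> k; rewrite [adjmx v _ _]mxE vE eq_sym => /negPf->; rewrite conjc0 mul0r.
rewrite [adjmx v _ _]mxE vE eqxx conjc_real ptBE DS_stateE // !eqxx orbT mulr1.
by rewrite !mxE rmorphM.
Qed.

(** Each off-diagonal coefficient is halved but counted twice. This yields the trace of the
    state. *)
Lemma sum_Mmat (d : nat) (p : 'M[R]_d) : p^T = p ->
  \sum_i \sum_j Mmat p i j = \sum_(i < d) \sum_(j < d | (i <= j)%N) p i j.
Proof.
move=> ps; have symM i j : Mmat p i j = Mmat p j i by rewrite -{1}(Mmat_sym _ _ ps) mxE.
transitivity (\sum_(i < d) \sum_(j < d | (i <= j)%N) Mmat p i j +
              \sum_(i < d) \sum_(j < d | (i < j)%N) Mmat p i j).
  rewrite [X in _ + X](exchange_big_dep xpredT) //= -big_split /=.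
  apply: eq_bigr => i _; rewrite (bigID (fun j : 'I_d => (i <= j)%N)) /=.
  congr (_ + _); apply: eq_big => j; first by rewrite -ltnNge.
  by move=> _; rewrite symM.
rewrite -big_split /=; apply: eq_bigr => i _.
rewrite (bigD1 i) //= [RHS](bigD1 i) //= mxE eqxx -addrA; congr (_ + _).
rewrite [X in _ + X](eq_bigl (fun j : 'I_d => (i <= j)%N && (j != i))); last first.
  by move=> j; rewrite ltn_neqAle eq_sym andbC.
rewrite -big_split /=; apply: eq_bigr => j /andP[_ ji].
by rewrite mxE eq_sym (negPf ji) -splitr.
Qed.

End Entries.

(** * Separability from sums of product vectors *)

Section ProductVectors.
Local Open Scope complex_scope.
Variable R : realType.
Local Notation C := R[i].

Lemma psd_rank1 (d : nat) (x : 'cV[C]_d) : psd (x *m adjmx x).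
Proof.
split=> [|v].
  apply/matrixP => i j; rewrite mxE !mxE !big_ord1 !mxE rmorphM /= conjcK.
  by rewrite mulrC.
have -> : (adjmx v *m (x *m adjmx x) *m v) 0 0
    = (adjmx v *m x) 0 0 * ((adjmx v *m x) 0 0)^*%C.
  rewrite mulmxA -[LHS]/((_ *m _ *m _) 0 0) -mulmxA mxE big_ord1; congr (_ * _).
  rewrite !mxE rmorph_sum; apply: eq_bigr => i _.
  by rewrite !mxE rmorphM /= conjcK mulrC.
exact: mulcJ_ge0.
Qed.

(** Separability asks for factors of trace one, so the squared norm of [x] is split off as a
    weight. *)
Lemma rank1_scaled_state (d : nat) (x : 'cV[C]_d) : (0 < d)%N ->
  exists wA : R * 'M[C]_d,
    [/\ 0 <= wA.1, is_state wA.2 & x *m adjmx x = wA.1%:C *: wA.2].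
Proof.
move=> d_gt0; pose e : 'cV[C]_d := delta_mx (Ordinal d_gt0) 0.
have tr_rank1 (y : 'cV[C]_d) : \tr (y *m adjmx y) = \sum_i `|y i 0| ^+ 2.
  by apply: eq_bigr => i _; rewrite mxE big_ord1 mxE -sqr_normc.
have tr_ge0 : 0 <= \tr (x *m adjmx x).
  by rewrite tr_rank1 sumr_ge0 // => i _; rewrite exprn_ge0.
have [n nE] : exists n : R, \tr (x *m adjmx x) = n%:C.
  by exists (complex.Re (\tr (x *m adjmx x))); rewrite RRe_real // ger0_real.
rewrite nE ler0c in tr_ge0.
have [n0|n_neq0] := eqVneq n 0.
  (* The zero vector cannot be normalized: it gets weight 0 and the placeholder state [|0><0|],
     which exists as [d > 0]. *)
  exists (0, e *m adjmx e); split=> //=.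
    split; first exact: psd_rank1.
    rewrite tr_rank1 (bigD1 (Ordinal d_gt0)) //= big1 ?addr0 => [|i ne].
      by rewrite mxE !eqxx normr1 expr1n.
    by rewrite mxE (negPf ne) normr0 expr0n.
  suff -> : x = 0 by rewrite mul0mx scale0r.
  move: nE; rewrite tr_rank1 n0 => /eqP; rewrite psumr_eq0 => [/allP x0|i _]; last first.
    by rewrite exprn_ge0.
  apply/matrixP => i j; rewrite ord1 mxE; apply/eqP.
  by have := x0 i; rewrite mem_index_enum sqrf_eq0 normr_eq0 => /(_ isT).
exists (n, n^-1%:C *: (x *m adjmx x)); split=> //=; last first.
  by rewrite scalerA -rmorphM /= divff // scale1r.
split; last by rewrite linearZ /= nE -rmorphM /= mulVf.
have [herm pos] := psd_rank1 _ x; split=> [|v].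
  apply/matrixP => i j; rewrite [LHS]mxE mxE [RHS]mxE rmorphM [X in X * _]conjc_real.
  by congr (_ * _); rewrite -[in RHS]herm [RHS]mxE.
by rewrite -scalemxAr -scalemxAl mxE mulr_ge0 // ler0c invr_ge0.
Qed.

Lemma tr_kron (d : nat) (A B : 'M[C]_d) : \tr (kron A B) = \tr A * \tr B.
Proof.
rewrite /mxtrace sum_mxvec_index big_distrl /=; apply: eq_bigr => i _.
by rewrite big_distrr /=; apply: eq_bigr => k _; rewrite kronE.
Qed.

Lemma kron_scale (d : nat) (a b : C) (A B : 'M[C]_d) :
  kron (a *: A) (b *: B) = (a * b) *: kron A B.
Proof.
apply/matrixP => m n.
case: (mxvec_indexP m) => i k; case: (mxvec_indexP n) => j l.
by rewrite [RHS]mxE !kronE !mxE mulrACA.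
Qed.

(** After normalization each product state has trace one, so the weights sum to the trace of [rho],
    which is 1. *)
Lemma separable_sum_product_vectors (T : finType) (d : nat) (c : R) (x y : T -> 'cV[C]_d)
    (rho : 'M[C]_(d * d)) : (0 < d)%N -> 0 <= c -> \tr rho = 1 ->
    rho = c%:C *: \sum_t kron (x t *m adjmx (x t)) (y t *m adjmx (y t)) ->
  separable rho.
Proof.
move=> d_gt0 c_ge0 tr1 rhoE.
have [wA wAP] := fin_all_exists (fun t => rank1_scaled_state d (x t) d_gt0).
have [wB wBP] := fin_all_exists (fun t => rank1_scaled_state d (y t) d_gt0).
pose w t := c * ((wA t).1 * (wB t).1).
have rhoE' : rho = \sum_t (w t)%:C *: kron (wA t).2 (wB t).2.
  rewrite rhoE scaler_sumr; apply: eq_bigr => t _.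
  have [_ _ ->] := wAP t; have [_ _ ->] := wBP t.
  by rewrite kron_scale scalerA -!rmorphM.
exists #|T|, (fun k => w (enum_val k)), (fun k => (wA (enum_val k)).2),
  (fun k => (wB (enum_val k)).2); split.
  move=> k; have [? _ _] := wAP (enum_val k); have [? _ _] := wBP (enum_val k).
  by rewrite !mulr_ge0.
split.
  apply: (@complexI R); rewrite rmorph1 -tr1 rhoE' linear_sum rmorph_sum /=.
  rewrite [RHS](reindex _ (onW_bij _ (enum_val_bij _))) /=; apply: eq_bigr => k _.
  have [_ [_ trA] _] := wAP (enum_val k); have [_ [_ trB] _] := wBP (enum_val k).
  by rewrite linearZ /= tr_kron trA trB !mulr1.
split; first by move=> k; have [] := wAP (enum_val k).
split; first by move=> k; have [] := wBP (enum_val k).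
by rewrite rhoE' (reindex _ (onW_bij _ (enum_val_bij _))).
Qed.

(** * Averaging over fourth roots of unity *)

Definition phase (n : 'I_4) : C := 'i ^+ n.

Lemma expi4 : ('i : C) ^+ 4 = 1.
Proof. by rewrite (exprM _ 2 2) sqr_i sqrrN expr1n. Qed.

Lemma phase_add1 (n : 'I_4) : phase (n + 1) = 'i * phase n.
Proof. by rewrite /phase /= expr_mod ?expi4 // addn1 exprS. Qed.

Lemma phase_mul_conj (n : 'I_4) : phase n * (phase n)^* = 1.
Proof.
rewrite /phase rmorphXn -exprMn /=; set z := _ * _.
suff -> : z = 1 by rewrite expr1n.
by apply/eqP; rewrite /z eq_complex /=; apply/andP; split; apply/eqP; ring.
Qed.

(** The unnormalized moment of [z_i z_k] against [z_j z_l] for independent phases. Signs would not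
    suffice: [z_i^2 = 1] would keep the entries [|ii><jj|]. Exponents in ['I_4] form a group, which
    allows reindexing by translation. *)
Definition phase_sum (d : nat) (i k j l : 'I_d) : C :=
  \sum_(f : {ffun 'I_d -> 'I_4})
    (phase (f i) * phase (f k) * (phase (f j) * phase (f l))^*%C).

(* Shifting the i-th phase multiplies the summand by 'i or 'i ^+ 2 = -1. *)
Lemma phase_sum_notin (d : nat) (i k j l : 'I_d) :
  i != j -> i != l -> phase_sum d i k j l = 0.
Proof.
move=> ij il; pose h : {ffun 'I_d -> 'I_4} := [ffun x => if x == i then 1 else 0].
pose shift (f : {ffun 'I_d -> 'I_4}) := f + h.
have shift_inj : injective shift by apply: addIr.
have hi (f : {ffun 'I_d -> 'I_4}) : phase (shift f  i) = 'i * phase (f i).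
  by rewrite /shift !ffunE eqxx phase_add1.
have hn (f : {ffun 'I_d -> 'I_4}) a : a != i -> phase (shift f  a) = phase (f a).
  by move=> /negPf ne; rewrite /shift !ffunE ne addr0.
(* Translation permutes the assignments, so the sum equals [z] times itself for some [z != 1] and
   must vanish. *)
have [z z1 zE] : exists2 z : C, z != 1 & phase_sum d i k j l = z * phase_sum d i k j l.
  exists ('i * if k == i then 'i else 1).
    case: (k == i); last by rewrite mulr1 eq_complex /= oner_eq0 andbF.
    by rewrite -expr2 sqr_i lt_eqF // (lt_trans (ltrN10 _) ltr01).
  rewrite /phase_sum {1}(reindex_inj shift_inj) big_distrr /=.
  apply: eq_bigr => f _; rewrite hi (hn _ j) 1?eq_sym // (hn _ l) 1?eq_sym //.
  case: (eqVneq i k) => [<-|ki] /=; first by rewrite hi mulrACA !mulrA.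
  by rewrite hn 1?eq_sym // mulr1 !mulrA.
apply/eqP; move/eqP: zE; rewrite -subr_eq0 -{1}[phase_sum _ _ _ _ _]mul1r -mulrBl mulf_eq0.
by rewrite subr_eq0 eq_sym (negPf z1).
Qed.

(** If the unordered pairs agree, each of the [4 ^ d] summands is 1. Otherwise some index of one
    pair is missing from the other; swapping within a pair and conjugating bring it to the first
    position, where the shift argument applies. *)
Lemma phase_sumE (d : nat) (i k j l : 'I_d) :
  phase_sum d i k j l =
  (4 ^ d)%:R * (((i == j) && (k == l)) || ((i == l) && (k == j)))%:R.
Proof.
have swapl a b c e : phase_sum d a b c e = phase_sum d b a c e.
  by apply: eq_bigr => f _; rewrite [phase (f a) * _]mulrC.
have conjS a b c e : phase_sum d a b c e = (phase_sum d c e a b)^*%C.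
  rewrite rmorph_sum; apply: eq_bigr => f _.
  by rewrite [RHS]rmorphM /= conjcK mulrC.
case: (boolP (_ || _)) => [E|].
  rewrite mulr1n mulr1 -[in RHS](card_ord 4) -{2}(card_ord d) -card_ffun -sumr_const.
  apply: eq_bigr => f _.
  transitivity ((phase (f i) * (phase (f i))^*%C) * (phase (f k) * (phase (f k))^*%C)).
    by rewrite rmorphM /=; case/orP: E => /andP[/eqP<- /eqP<-]; ring.
  by rewrite !phase_mul_conj mulr1.
rewrite negb_or !negb_and mulr0.
case: (eqVneq i j) => [<-|ij] /=.
  case: (eqVneq i l) => [<-|il] /=; last first.
    move=> /andP[kl _]; case: (eqVneq k i) => [->|ki]; last first.
      by rewrite swapl phase_sum_notin.
    rewrite conjS.
    have -> : phase_sum d i l i i = 0 by rewrite swapl phase_sum_notin // eq_sym.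
    exact: conjc0.
  by rewrite andbb => ki; rewrite swapl phase_sum_notin.
case: (eqVneq i l) => [<-|il] /=; last by rewrite phase_sum_notin.
case: (eqVneq k j) => // kj _; case: (eqVneq k i) => [->|ki]; last first.
  by rewrite swapl phase_sum_notin.
rewrite conjS phase_sum_notin ?conjc0 // eq_sym //.
Qed.

(** An entry of the doubled projector carries four amplitudes; the square roots make them multiply
    to [u i * u k] when the index pairs match. *)
Definition phased_vector (d : nat) (u : 'I_d -> R) (f : {ffun 'I_d -> 'I_4}) : 'cV[C]_d :=
  \col_i ((Num.sqrt (u i))%:C * phase (f i)).

Lemma phase_average (d : nat) (u : 'I_d -> R) (i k j l : 'I_d) :
    (forall a, 0 <= u a) ->
  \sum_f (let A := phased_vector d u f *m adjmx (phased_vector d u f) in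
          kron A A (mxvec_index i k) (mxvec_index j l)) =
  (4 ^ d)%:R * ((u i * u k)%:C *
    (((i == j) && (k == l)) || ((i == l) && (k == j)))%:R).
Proof.
move=> u_ge0; pose s a : C := (Num.sqrt (u a))%:C.
have s2 a : s a * s a = (u a)%:C by rewrite -rmorphM /= -expr2 sqr_sqrtr.
transitivity (s i * s k * (s j * s l) * phase_sum d i k j l).
  rewrite big_distrr /=; apply: eq_bigr => f _.
  have conjE a : (s a * phase (f a))^*%C = s a * (phase (f a))^*%C.
    by rewrite rmorphM [X in X * _]conjc_real.
  rewrite kronE !mxE !big_ord1 !mxE !conjE [(phase _ * phase _)^*%C]rmorphM /=.
  by rewrite /s; ring.
rewrite phase_sumE mulrCA; congr (_ * _).
case: (boolP (_ || _)) => [E|_]; last by rewrite !mulr0.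
rewrite rmorphM /= -!s2; congr (_ * _).
by case/orP: E => /andP[/eqP<- /eqP<-]; ring.
Qed.

End ProductVectors.

(** * Assembling the separable decomposition *)

Lemma tr_DS_state (R : realType) (d : nat) (p : 'M[R]_d) :
  DS_coeffs p -> \tr (DS_state p) = 1.
Proof.
move=> [ps [_ p1]]; rewrite -(rmorph1 (real_complex R)) -p1 -sum_Mmat //.
rewrite /mxtrace sum_mxvec_index rmorph_sum; apply: eq_bigr => i _.
rewrite rmorph_sum; apply: eq_bigr => k _.
by rewrite DS_stateE // !eqxx mulr1.
Qed.

Theorem theorem4 (R : realType) (d : nat) (p : 'M[R]_d) :
  (2 <= d)%N -> DS_coeffs p ->
  PPT (DS_state p) -> (\rank (Mmat p) <= 2)%N ->
  separable (DS_state p).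
Proof.
move=> d_ge2 DSp ppt rk2; have [ps [p_ge0 _]] := DSp.
have [u [v uvM]] := psd_rank2 _ _ _ (Mmat_sym _ _ _ ps) (PPT_Mmat_psd _ _ _ ps ppt) rk2.
have acute i j : 0 <= u i * u j + v i * v j.
  by rewrite -uvM mxE; case: eqP => // _; rewrite divr_ge0.
have [u' [v' [u'_ge0 v'_ge0 uvE]]] := acute_planar_family_nonneg _ _ _ _ acute.
pose x (t : {ffun 'I_d -> 'I_4} + {ffun 'I_d -> 'I_4}) := match t with
  | inl f => phased_vector R d u' f
  | inr f => phased_vector R d v' f end.
(* The factor is [1 / 4 ^ d] although there are [2 * 4 ^ d] vectors: the averages for [u'] and [v']
   are added, not averaged together. *)
apply: (separable_sum_product_vectors R _ d (4 ^ d)%:R^-1 x x).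
- exact: ltnW.
- by rewrite invr_ge0.
- exact: tr_DS_state.
apply/matrixP => a b; case: (mxvec_indexP a) => i k; case: (mxvec_indexP b) => j l.
rewrite DS_stateE // uvM uvE [RHS]mxE big_sumType /= mxE !summxE !phase_average //.
rewrite -mulrDr -mulrDl -rmorphD /= mulrA -(rmorph_nat (real_complex R) (4 ^ d)) -rmorphM /=.
by rewrite mulVf ?mul1r // pnatr_eq0 expn_eq0.
Qed.
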